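(* Let $n\geq 1$ be an integer and let $d\colon\mathbb{R}\to\mathbb{R}$ be a derivation. Let $d^k$ denote the $k$-fold iterate (composition) of $d$. Then the following statements are equivalent: (i) There exist $c_0,c_1,\dots,c_n\in\mathbb{R}$ such that $c_0^2+c_1^2+\cdots+c_n^2>0$ and $c_0x+c_1d(x)+\cdots+c_nd^n(x)=0$ for all $x\in\mathbb{R}$; (ii) There exists an upper semicontinuous function $\Phi\colon\mathbb{R}^{n+1}\to\mathbb{R}$ which is not nonnegative everywhere (i.e. $\Phi(p)<0$ for some $p\in\mathbb{R}^{n+1}$) and such that $\Phi(x,d(x),\dots,d^n(x))\geq 0$ for all $x\in\mathbb{R}$; (iii) The set $\{(x,d(x),\dots,d^n(x))\mid x\in\mathbb{R}\}$ is not dense in $\mathbb{R}^{n+1}$; (iv) $d=0$.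
   Context: A derivation $d\colon\mathbb{R}\to\mathbb{R}$ is a function that is additive, $d(x+y)=d(x)+d(y)$ for all $x,y\in\mathbb{R}$, and satisfies the Leibniz rule $d(xy)=x\,d(y)+y\,d(x)$ for all $x,y\in\mathbb{R}$ (no continuity or $\mathbb{R}$-linearity is assumed). Iterates are defined by $d^0:=\mathrm{id}$, $d^1:=d$, and $d^{k}:=d\circ d^{k-1}$. $\mathbb{R}^{n+1}$ carries its usual topology. *)

(* Defs.v *)
From HB Require Import structures.
From mathcomp Require Import all_boot all_order all_algebra.
From mathcomp Require Import all_classical all_reals all_analysis.
Set Implicit Arguments.
Unset Strict Implicit.
Unset Printing Implicit Defensive.
Import Order.TTheory GRing.Theory Num.Theory.
Import numFieldNormedType.Exports.
Local Open Scope classical_set_scope.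
Local Open Scope ring_scope.

Definition is_derivation (R : realType) (d : R -> R) : Prop :=
  (forall x y, d (x + y) = d x + d y) /\
  (forall x y, d (x * y) = x * d y + y * d x).

(* Real-valued counterpart of the library's [lower_semicontinuous], which is
   restricted to functions into [\bar R]. *)
Definition upper_semicontinuous (R : realType) (T : topologicalType)
    (f : T -> R) : Prop :=
  forall (x : T) (a : R), f x < a -> \forall y \near x, f y < a.

(* The point (x, d x, ..., d^n x) of R^(n+1). *)
Definition iter_row (R : realType) (n : nat) (d : R -> R) (x : R) :
    'rV[R]_n.+1 :=
  \row_(k < n.+1) iter k d x.

(* Main.v *)
Require Import Defs.
From HB Require Import structures.
From mathcomp Require Import all_boot all_order all_algebra.
From mathcomp Require Import all_classical all_reals all_analysis.
Set Implicit Arguments.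
Unset Strict Implicit.
Unset Printing Implicit Defensive.
Import Order.TTheory GRing.Theory Num.Theory.
Import numFieldNormedType.Exports.
Local Open Scope classical_set_scope.
Local Open Scope ring_scope.

(** The substantial implication is from non-density to [d = 0], in contraposed
    form: if [d a != 0] for some [a], then the points [(x, d x, .., d^n x)]
    are dense ([dense_iter_row]).

    The reason is first algebraic. The operators [id, d, .., d^n] are linearly
    independent over [R] ([derivation_iter_free]). Indeed, if [D = \sum_k c_k
    d^k] of order [m >= 1] vanishes, then so does its commutator with
    multiplication by [a]. By the Leibniz formula this commutator is an
    operator of order [m - 1] in [d], with leading coefficient [m c_m d(a)],
    so induction on the order gives [c_m = 0].

    Hence no nonzero linear functional kills all the points, and some finitely
    many of them span the whole space ([exists_row_full]).

    It remains to pass from spanning to density. The iterates of [d] are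
    additive, hence linear over the rationals, so the set of points contains
    all rational combinations of the spanning ones. These are dense because
    all real combinations fill the space ([dense_ratr_combinations]).

    The other implications are soft. A linear relation yields the continuous
    function [- L^2], where [L] is the linear form of the relation; a negative
    value of an upper semicontinuous function produces a nonempty open set
    missed by the points; and [d = 0] is itself a linear relation, involving
    [d^1] only. *)

Lemma additive_ratrZ (R : realType) (f : {additive R -> R}) (q : rat) (x : R) :
  f (ratr q * x) = ratr q * f x.
Proof.
have den0 : (denq q)%:~R != 0 :> R by rewrite intr_eq0 denq_eq0.
apply: (mulfI den0); rewrite mulrA mulrzl -raddfMz -mulrzl mulrA.
have -> : (denq q)%:~R * ratr q = (numq q)%:~R :> R.
  by rewrite /ratr mulrC divfK.
by rewrite !mulrzl raddfMz.
Qed.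

(** Packaging the iterate as an additive morphism gives access to the generic
    lemmas on sums, multiples and rational scaling. *)
Lemma derivation_iter_additive (R : realType) (d : R -> R) (k : nat) :
  is_derivation d -> exists f : {additive R -> R}, iter k d =1 f.
Proof.
move=> [dD _].
have iterD x y : iter k d (x + y) = iter k d x + iter k d y.
  by elim: k => //= k ->; rewrite dD.
have iterB : zmod_morphism (iter k d).
  by move=> x y; apply/eqP; rewrite -subr_eq opprK -iterD subrK.
pose aM := GRing.isZmodMorphism.Build R R (iter k d) iterB.
pose f : {additive R -> R} := HB.pack (iter k d) aM.
by exists f.
Qed.

(** The summation range is any [N > k] rather than [k.+1]: the binomials vanish
    beyond [k], and a range independent of [k] lets the formula be summed over
    [k] with the two sums exchanged. *)
Lemma derivation_Leibniz (R : realType) (d : R -> R) (a x : R) (N k : nat) :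
    is_derivation d -> (k < N)%N ->
  iter k d (a * x) =
    \sum_(j < N) iter (k - j) d a * iter j d x *+ 'C(k, j).
Proof.
move=> hd; have [f fE] := derivation_iter_additive 1 hd.
have {}fE x0 : d x0 = f x0 := fE x0.
case: (hd) => _ dM.
case: N => // N; elim: k => [|k IH] kN.
  by rewrite big_ord_recl big1 ?addr0.
rewrite iterS IH ?(ltnW kN)// fE raddf_sum.
under eq_bigr => j _ do rewrite raddfMn /= -fE /= dM mulrnDl.
rewrite big_split /= big_ord_recr /= bin_small // mulr0n addr0.
(* Shifting the index in the second sum turns the claim into Pascal's rule. *)
rewrite [X in _ + X]big_ord_recl [RHS]big_ord_recl /= addrCA; congr (_ + _).
  by rewrite !bin0 !subn0 mulrC.
rewrite -big_split /=; apply: eq_bigr => j _; rewrite /bump /= add1n binS.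
rewrite subSS mulrnDr addrC; congr (_ + _).
have [jk|jk] := leqP j.+1 k; last by rewrite bin_small// !mulr0n.
by rewrite -(subnSK jk) mulrC.
Qed.

(** Applying the relation to [a * x] and subtracting [a] times the relation at
    [x] gives a relation with one term less, whose last coefficient is a
    positive integer multiple of [d a] times the last of the [c k]; induction
    and characteristic zero force the latter to vanish. For
    a single term, evaluate at [1]. *)
Lemma derivation_iter_free (R : realType) (d : R -> R) (a : R) (m : nat)
    (c : nat -> R) :
    is_derivation d -> d a != 0 ->
    (forall x, \sum_(k < m) c k * iter k d x = 0) ->
  forall k, (k < m)%N -> c k = 0.
Proof.
move=> hd da; elim: m c => [//|m IH] c c0.
suff cm : c m = 0.
  move=> k; rewrite ltnS leq_eqVlt => /orP[/eqP->//|]; apply: IH => x.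
  by have := c0 x; rewrite big_ord_recr /= cm mul0r addr0.
case: m IH c0 => [|m] IH c0.
  by have := c0 1; rewrite big_ord1 /= mulr1.
(* [e j] is the coefficient of [d^j x] in the relation evaluated at [a * x]. *)
pose e j := \sum_(k < m.+2) c k * (iter (k - j) d a *+ 'C(k, j)).
have e0 x : \sum_(j < m.+2) e j * iter j d x = 0.
  rewrite -[RHS](c0 (a * x)); under eq_bigr => j _ do rewrite mulr_suml.
  rewrite exchange_big; apply: eq_bigr => k _.
  rewrite (derivation_Leibniz a x hd (ltn_ord k)) mulr_sumr.
  by apply: eq_bigr => j _; rewrite -mulrA mulrnAl.
have eS : e m.+1 = a * c m.+1.
  rewrite /e big_ord_recr /= subnn binn mulr1n mulrC big1 ?add0r // => i _.
  by rewrite bin_small // mulr0n mulr0.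
have em : e m = a * c m + c m.+1 * d a *+ m.+1.
  rewrite /e !big_ord_recr /= subnn binn subSn // subnn binSn mulr1n.
  rewrite big1 ?add0r => [|i _]; last by rewrite bin_small // mulr0n mulr0.
  by rewrite mulrC -mulrnAr.
(* The relation given by the commutator: its coefficient at [d^(m+1)]
   cancels by [eS]. *)
have be x : \sum_(j < m.+1) (e j - a * c j) * iter j d x = 0.
  have := e0 x; rewrite big_ord_recr /= eS -mulrA => /eqP.
  have := c0 x; rewrite big_ord_recr /= => /eqP.
  rewrite !addr_eq0 => /eqP c0x /eqP e0x.
  under eq_bigr => j _ do rewrite mulrBl -mulrA.
  by rewrite sumrB -mulr_sumr c0x e0x mulrN subrr.
have /eqP := IH (fun j => e j - a * c j) be m (ltnSn m).
by rewrite em addrC addKr mulrn_eq0 mulf_eq0 (negbTE da) orbF => /eqP.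
Qed.

(** As long as the chosen values do not span, some column of the cokernel of
    their matrix is a nonzero functional killing them; a value not killed by it
    lies outside their span and increases the rank. *)
Lemma exists_row_full (F : fieldType) (T : Type) (n : nat) (f : T -> 'rV[F]_n) :
    (forall c : 'cV[F]_n, (forall x, f x *m c = 0) -> c = 0) ->
  exists m (y : 'I_m -> T), row_full (\matrix_(i < m) f (y i)).
Proof.
move=> f_sep.
suff H r : (r <= n)%N ->
    exists m (y : 'I_m -> T), (r <= \rank (\matrix_(i < m) f (y i)))%N.
  have [m [y ry]] := H n (leqnn n).
  by exists m, y; rewrite /row_full eqn_leq rank_leq_col.
elim: r => [_|r IH rn].
  by exists 0%N, (fun i : 'I_0 => False_rect T (notF (ltn_ord i))).
have [m [y ry]] := IH (ltnW rn); set A := (\matrix_(i < m) _) in ry.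
have [rA|rA] := ltnP r (\rank A); first by exists m, y.
have [x xA] : exists x, ~~ (f x <= A)%MS.
  apply: contrapT => /forallNP fA; have : row_full A.
    rewrite -cokermx_eq0; apply/eqP/matrixP => i j.
    have /matrixP/(_ i 0) : col j (cokermx A) = 0.
      apply: f_sep => x; rewrite colE mulmxA.
      by move: (fA x) => /negP/negPn; rewrite submxE => /eqP ->; rewrite mul0mx.
    by rewrite !mxE.
  by rewrite /row_full => /eqP rE; rewrite rE leqNgt rn in rA.
pose z (i : 'I_m.+1) := oapp y x (unlift ord0 i).
exists m.+1, z; apply: (leq_ltn_trans ry); apply: rank_ltmx.
rewrite ltmxE; apply/andP; split.
  apply/row_subP => i; rewrite rowK.
  rewrite (_ : f (y i) = row (lift ord0 i) (\matrix_j f (z j))) ?row_sub //.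
  by rewrite rowK /z liftK.
apply: contra xA; apply: submx_trans.
rewrite (_ : f x = row ord0 (\matrix_j f (z j))) ?row_sub //.
by rewrite rowK /z unlift_none.
Qed.

(** Full row rank makes every vector some [u *m A] with [u] real; since
    [u |-> u *m A] is Lipschitz, it suffices to approximate [u] by a rational
    row. *)
Lemma dense_ratr_combinations (R : realType) (m n : nat) (A : 'M[R]_(m, n)) :
    row_full A ->
  dense (range (fun q : 'rV[rat]_m => map_mx ratr q *m A)).
Proof.
move=> fullA O [p Op] oO.
have /submxP[u pE] : (p <= A)%MS := submx_full p fullA.
have /nbhs_ballP[e /= e0 eO] : nbhs p O by exact: open_nbhs_nbhs.
(* The sum [S] of the absolute values of all entries dominates that of each
   column, hence is a common Lipschitz constant for all coordinates; [1 + S]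
   avoids dividing by zero. *)
pose S := \sum_j \sum_i `|A i j|.
have S0 : 0 < 1 + S.
  by rewrite ltr_pwDl // sumr_ge0 // => j _; rewrite sumr_ge0.
pose del := e / (1 + S).
have del0 : 0 < del by rewrite divr_gt0.
have /choice[q qu] : forall i, exists r : rat, `|u 0 i - ratr r| < del.
  move=> i; have /rat_in_itvoo[r] : u 0 i - del < u 0 i + del.
    by rewrite ltrD2l gt0_cp.
  by rewrite in_itv /= -ltr_distlC => ru; exists r.
exists (map_mx ratr (\row_i q i) *m A); split; last by exists (\row_i q i).
apply: eO; split=> // i j; rewrite ord1 /ball /= pE.
(* The ball of matrices unfolds to entrywise distances. *)
rewrite -[X in `|X|]/((u *m A) 0 j + - (map_mx ratr (\row_i q i) *m A) 0 j).
rewrite !mxE -sumrB.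
have lt1 : del * S < e.
  by rewrite /del mulrAC ltr_pdivrMr // ltr_pM2l // ltr_pwDl.
apply: le_lt_trans lt1; apply: le_trans (ler_norm_sum _ _ _) _.
apply: (@le_trans _ _ (\sum_i del * `|A i j|)).
  apply: ler_sum => k _; rewrite !mxE -mulrBl normrM ler_wpM2r //.
  exact: ltW.
rewrite -mulr_sumr ler_pM2l // /S (bigD1 j) //= lerDl sumr_ge0 // => l _.
by rewrite sumr_ge0.
Qed.

Lemma dense_iter_row (R : realType) (n : nat) (d : R -> R) (a : R) :
  is_derivation d -> d a != 0 -> dense (range (iter_row n d)).
Proof.
move=> hd da.
have [m [y fullY]] : exists m (y : 'I_m -> R),
    row_full (\matrix_(i < m) iter_row n d (y i)).
  apply: exists_row_full => c c0.
  apply/matrixP => i j; rewrite ord1 mxE.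
  (* The coefficients, extended by zero to all natural indices. *)
  pose c' k := if insub k is Some i then c i 0 else 0.
  have c'E (k : 'I_n.+1) : c' k = c k 0 by rewrite /c' valK.
  rewrite -c'E; apply: (derivation_iter_free (m := n.+1) hd da) => // x.
  have /matrixP/(_ 0 0) := c0 x; rewrite !mxE => cx; rewrite -[RHS]cx.
  by apply: eq_bigr => k _; rewrite !mxE c'E mulrC.
move=> O O0 oO.
have [p [Op [q _ qE]]] := dense_ratr_combinations fullY O0 oO.
exists (iter_row n d (\sum_i ratr (q 0 i) * y i)); split; last by eexists.
suff -> : iter_row n d (\sum_i ratr (q 0 i) * y i) =
    map_mx ratr q *m (\matrix_i iter_row n d (y i)) by rewrite qE.
apply/rowP => k; rewrite !mxE.
have [f fE] := derivation_iter_additive k hd.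
rewrite fE raddf_sum; apply: eq_bigr => i _.
by rewrite /= additive_ratrZ !mxE fE.
Qed.

Theorem corollary9 (R : realType) (n : nat) (hn : (1 <= n)%N) (d : R -> R)
    (hd : is_derivation d) :
  [<->
    (* (i) *)
    exists c : 'I_n.+1 -> R,
      0 < \sum_(k < n.+1) c k ^+ 2 /\
      (forall x : R, \sum_(k < n.+1) c k * iter k d x = 0);
    (* (ii) *)
    exists Phi : 'rV[R]_n.+1 -> R,
      [/\ upper_semicontinuous Phi,
          exists p : 'rV[R]_n.+1, Phi p < 0 &
          forall x : R, 0 <= Phi (iter_row n d x)];
    (* (iii) *)
    ~ dense [set iter_row n d x | x in [set: R]];
    (* (iv) *)
    d = cst 0].
Proof.
tfae.
- move=> [c [c_gt0 c0]].
  pose L (p : 'rV[R]_n.+1) := \sum_k c k * p 0 k.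
  have L_cont : continuous L.
    apply: continuous_big => [|k _ p]; first exact: add_continuous.
    by apply: continuousM; [exact: cst_continuous|exact: coord_continuous].
  exists (fun p => - (L p * L p)); split.
  + move=> p b pb.
    have LL_cont := continuousN (continuousM (L_cont p) (L_cont p)).
    exact: (LL_cont [set r | r < b] (lt_nbhsl pb)).
  + exists (\row_k c k); rewrite oppr_lt0 -expr2 exprn_gt0 //.
    (* The value of [L] at [c] is the sum of the squares of the [c k]. *)
    rewrite /L; under eq_bigr => k _ do rewrite mxE -expr2.
    exact: c_gt0.
  + move=> x; suff L0 : L (iter_row n d x) = 0 by rewrite /= L0 mul0r oppr0.
    by rewrite -[RHS](c0 x); apply: eq_bigr => k _; rewrite mxE.
- move=> [Phi [usc [p p0] Phi_ge0]] /(_ [set p | Phi p < 0]) [|//|q []].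
  + by exists p.
  + by rewrite openE => q /= q0; exact: usc.
  + by move=> q0 [x _ xq]; move: q0; rewrite /= -xq ltNge Phi_ge0.
- move=> ndense; apply/funext => a; apply/eqP/negPn/negP => da.
  by apply: ndense; exact: dense_iter_row hd da.
- move=> d0; exists (fun k : 'I_n.+1 => (k == 1 :> nat)%:R).
  have n1 : (1 < n.+1)%N by [].
  split.
  + by rewrite (bigD1 (Ordinal n1)) //= expr1n ltr_pwDl // sumr_ge0 // => k _;
      rewrite sqr_ge0.
  + move=> x; rewrite (bigD1 (Ordinal n1)) //= d0 mulr0 add0r big1 // => k k1.
    by rewrite -val_eqE /= in k1; rewrite (negbTE k1) mul0r.
Qed.
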